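(* Let $f \subseteq \mathcal{X} \times \mathcal{Y} \times \mathcal{Z}$ be a (complete) relation and $\mu$ a distribution on $\mathcal{X}\times\mathcal{Y}$. Let $0 < 200\sqrt{\delta} < \epsilon < 0.5$ and let $k$ be a natural number. Then $$ \mathrm{rment}^{\mu^{k}}_{1-(1-\epsilon/2)^{\lfloor \delta k\rfloor}}(f^k) \geq \delta \cdot k \cdot \mathrm{crment}^{\mu}_{\epsilon,\epsilon}(f). $$
   Context: $\mathcal{X},\mathcal{Y},\mathcal{Z}$ are finite sets. The relation $f$ is complete, i.e. for every $(x,y)$ some $z$ has $(x,y,z)\in f$. Logarithms are base $2$. For a distribution $\lambda$ on a product set, $\lambda(x|y)=\lambda(x,y)/\lambda(y)$ and $\lambda(y|x)=\lambda(x,y)/\lambda(x)$. $f^k\subseteq\mathcal{X}^k\times\mathcal{Y}^k\times\mathcal{Z}^k$ is the relation with $((x_1,\dots,x_k),(y_1,\dots,y_k),(z_1,\dots,z_k))\in f^k$ iff $(x_i,y_i,z_i)\in f$ for all $i$. The distribution $\mu^k$ on $\mathcal{X}^k\times\mathcal{Y}^k$ is the product of $k$ independent copies of $\mu$, each on a pair $(x_i,y_i)$. For a relation $h\subseteq A\times B\times C$ and distributions $\lambda,\nu$ on $A\times B$: - $\lambda$ is one-way for $\nu$ if $\nu(b|a)=\lambda(b|a)$ for all $(a,b)$ in the support of $\lambda$. - $\mathrm{err}_h(\lambda)=\min_{g:B\to C}\Pr_{(a,b)\leftarrow\lambda}[(a,b,g(b))\notin h]$. - $S_\infty(\lambda\|\nu)=\max_{(a,b)}\log\frac{\lambda(a,b)}{\nu(a,b)}$.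 - $\mathrm{rment}^{\nu}_{\epsilon}(h)=\min\{S_\infty(\lambda\|\nu): \lambda\text{ one-way for }\nu,\ \mathrm{err}_h(\lambda)\le\epsilon\}$. - $\mathrm{crment}^{\nu}_{\delta}(\lambda)$ is the minimum $c$ with $\Pr_{(a,b)\leftarrow\lambda}[\log\frac{\lambda(a|b)}{\nu(a|b)}>c]\le\delta$. - $\mathrm{crment}^{\nu}_{\epsilon,\delta}(h)=\min\{\mathrm{crment}^{\nu}_{\delta}(\lambda): \lambda\text{ one-way for }\nu,\ \mathrm{err}_h(\lambda)\le\epsilon\}$. *)

(* Defs.v *)
From HB Require Import structures.
From mathcomp Require Import all_boot all_order all_algebra.
From mathcomp Require Import all_classical all_reals all_analysis.

Set Implicit Arguments.
Unset Strict Implicit.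
Unset Printing Implicit Defensive.

Import Order.TTheory GRing.Theory Num.Theory.

Local Open Scope ring_scope.

Definition is_dist (R : realType) (T : finType) (p : {ffun T -> R}) : Prop :=
  (forall t, 0 <= p t) /\ \sum_t p t = 1.

Definition prob (R : realType) (T : finType) (p : {ffun T -> R})
  (E : pred T) : R := \sum_(t | E t) p t.

Definition complete_rel (A B C : finType) (h : {set A * B * C}) : Prop :=
  forall a b, exists c, (a, b, c) \in h.

Definition rel_pow (X Y Z : finType) (f : {set X * Y * Z}) (k : nat) :
    {set {ffun 'I_k -> X} * {ffun 'I_k -> Y} * {ffun 'I_k -> Z}} :=
  [set t : {ffun 'I_k -> X} * {ffun 'I_k -> Y} * {ffun 'I_k -> Z} |
    [forall i, (t.1.1 i, t.1.2 i, t.2 i) \in f]].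

Definition dist_pow (R : realType) (X Y : finType) (mu : {ffun X * Y -> R})
    (k : nat) : {ffun {ffun 'I_k -> X} * {ffun 'I_k -> Y} -> R} :=
  [ffun t : {ffun 'I_k -> X} * {ffun 'I_k -> Y} =>
    \prod_(i < k) mu (t.1 i, t.2 i)].

Section Distributions.
Variables (R : realType) (A B : finType).
Implicit Types l nu : {ffun A * B -> R}.

Definition marg1 l (a : A) : R := \sum_(b : B) l (a, b).
Definition marg2 l (b : B) : R := \sum_(a : A) l (a, b).

(* l(a|b) and l(b|a); both are 0 when the conditioning event has
   probability 0. *)
Definition cond12 l (a : A) (b : B) : R := l (a, b) / marg2 l b.
Definition cond21 l (b : B) (a : A) : R := l (a, b) / marg1 l a.

(* If nu(a) = 0 while l(a,b) > 0, then nu(b|a) is undefined; here it is 0,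
   different from l(b|a) > 0, so such an l is not one-way for nu. *)
Definition one_way nu l : Prop :=
  forall a b, 0 < l (a, b) -> cond21 nu b a = cond21 l b a.

(* The logarithm of p / q in base 2, for p, q >= 0. Division and logarithm are
   those of \bar R: the value is +oo if p > 0 = q, and -oo if p = 0 (also when
   q = 0, so that points with p = q = 0 do not contribute to a maximum). *)
Definition log2_ratio (p q : R) : \bar R :=
  (lne (p%:E / q%:E) / (ln 2)%:E)%E.

(* The minimum over the finitely many guessing functions. The neutral element
   1 does not affect it, as it is an upper bound of all these probabilities. *)
Definition err (C : finType) (h : {set A * B * C}) l : R :=
  \big[Order.min/1]_(g : {ffun B -> C})
    prob l (fun t => (t.1, t.2, g t.2) \notin h).

Definition Sinf l nu : \bar R :=
  \big[Order.max/-oo%E]_(t : A * B) log2_ratio (l t) (nu t).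

(* The minima below are written as infima in \bar R. For 0 <= delta < 1 the
   minimum defining [crment_dist] is attained as soon as the set is nonempty,
   because c |-> Pr[_ > c] is a right-continuous step function tending to 1
   at -oo. When nu is a distribution, h is complete, 0 <= eps and
   0 <= delta < 1, the minima defining [rment] and [crment] are attained: the
   admissible l form a nonempty compact set, on which the minimized function
   is lower semicontinuous. *)
Definition rment (C : finType) nu (eps : R) (h : {set A * B * C}) : \bar R :=
  ereal_inf [set Sinf l nu | l in
    [set l | [/\ is_dist l, one_way nu l & err h l <= eps]]]%classic.

Definition crment_dist nu (delta : R) l : \bar R :=
  ereal_inf [set c%:E | c in
    [set c : R | prob l (fun t =>
       (c%:E < log2_ratio (cond12 l t.1 t.2) (cond12 nu t.1 t.2))%E)
         <= delta]]%classic.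

Definition crment (C : finType) nu (eps delta : R) (h : {set A * B * C}) :
    \bar R :=
  ereal_inf [set crment_dist nu delta l | l in
    [set l | [/\ is_dist l, one_way nu l & err h l <= eps]]]%classic.

End Distributions.

(* Main.v *)
(* Suppose [l] is one-way for [mu^k] with [Sinf l mu^k < delta k c], where [c] is
   at most the conditional min-entropy of [f], and some answer function wins all
   [k] games with probability at least [(1 - eps/2)^p], [p = floor (delta k)].

   If [delta c] is at most of order [eps], compare with [mu^k] itself: [c > 0]
   forces [err f mu > eps], so the winning probability under [mu^k] is at most
   [(1 - eps)^k], and [l <= 2^(delta k c) mu^k] gives a contradiction.

   Otherwise [c] is large.  Choose a set [C] of at most [p] coordinates such that,
   given success on [C], each other coordinate succeeds with probability at least
   [1 - eps/2]; let [P] be [l] conditioned on success on [C].  For [j] outside [C]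
   let [rho_j] reveal [x_i] for [i] in [C] or [i < j], and [y_i] for the other
   [i > j].  The products over [j] of the conditional laws of [x_j] given
   [rho_j, y_j], resp. of [y_j] given [rho_j, x_j], are again conditional laws of
   [x] given [y], resp. of [y] given [x], so Gibbs' inequality bounds the sum over
   [j] of the relative entropies of [x_j | y_j, rho_j] to [mu(x|y)] by about
   [delta k c], and that of [y_j | x_j, rho_j] to [mu(y|x)] by about [delta k eps]
   (only the conditioning moves [y] given [x]).  Given [rho_j], the law of
   [(x_j, y_j)] is thus on average nearly one-way, has [log (P(x|y) / mu(x|y))]
   rarely above [c - O(1)], and still admits an answer depending on [y_j] only,
   as [x] and the other [y_i] are independent given [rho_j] and [y_j].
   Averaging over [j] and [rho_j] and replacing [P(x,y)] by [P(x) mu(y|x)] yields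
   a one-way distribution contradicting the choice of [c]. *)

Require Import Defs.
From HB Require Import structures.
From mathcomp Require Import all_boot all_order all_algebra.
From mathcomp Require Import all_classical all_reals all_analysis.
From mathcomp Require Import ring lra.

Set Implicit Arguments.
Unset Strict Implicit.
Unset Printing Implicit Defensive.

Import Order.TTheory GRing.Theory Num.Theory.

Local Open Scope ring_scope.

(** * Relative entropy *)

Lemma ln_le_subr1 (R : realType) (x : R) : 0 < x -> ln x <= x - 1.
Proof.
move=> x0; have := @le_ln1Dx R (x - 1).
by rewrite (addrC 1) subrK; apply; lra.
Qed.

Lemma ln_prod (R : realType) (I : Type) (r : seq I) (P : pred I) (F : I -> R) :
  (forall i, P i -> 0 < F i) ->
  ln (\prod_(i <- r | P i) F i) = \sum_(i <- r | P i) ln (F i).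
Proof.
move=> F0.
suff [] : ln (\prod_(i <- r | P i) F i) = \sum_(i <- r | P i) ln (F i) /\
   0 < \prod_(i <- r | P i) F i by [].
elim/big_ind2 : _ => [|x1 x2 y1 y2 [<- x0] [<- y0]|i Pi].
- by rewrite ln1.
- by rewrite lnM ?posrE// mulr_gt0.
- by split; last exact: F0.
Qed.

Lemma support_nonempty (R : realType) (T : finType) (p : T -> R) :
  \sum_t p t = 1 -> exists t, p t != 0.
Proof.
move=> p1; apply: contrapT => /forallNP h; move: p1.
rewrite big1 => [/eqP|t _]; first by rewrite eq_sym oner_eq0.
by apply/eqP/negPn/negP/h.
Qed.

(** One term of a relative entropy, in nats; [p] and [q] need not come from normalised laws. *)
Definition kl (R : realType) (p q : R) : R := p * ln (p / q).

(** This is [ln x <= x - 1] at [x = q / p]. The linear term stays because the laws compared may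
    differ in mass. *)
Lemma kl_ge (R : realType) (p q : R) :
  0 <= p -> 0 <= q -> (0 < p -> 0 < q) -> p - q <= kl p q.
Proof.
rewrite /kl le0r => /orP[/eqP -> q0 _|p0 _ /(_ p0) q0].
  by rewrite mul0r sub0r oppr_le0.
have h : ln (q / p) <= q / p - 1 by rewrite ln_le_subr1// divr_gt0.
have -> : ln (p / q) = - ln (q / p).
  by rewrite !ln_div ?posrE// opprB.
have : p * ln (q / p) <= p * (q / p - 1) by rewrite ler_pM2l.
rewrite mulrBr mulrCA divff ?gt_eqF// !mulr1; lra.
Qed.

(* With [s = sqrt p] and [u = sqrt q], [kl p q >= 2 s (s - u)] and AM-GM
   bounds [|s - u| (s + u)]; this replaces Pinsker's inequality. *)
Lemma dist_le_kl (R : realType) (p q t : R) :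
  0 <= p -> 0 <= q -> (0 < p -> 0 < q) -> 0 < t ->
  `|p - q| <= t / 2 * (kl p q - p + q) + (p + q) / t.
Proof.
move=> p0 q0 pq t0.
have h : (Num.sqrt p - Num.sqrt q) ^+ 2 <= kl p q - p + q.
  have [p0'|p0'] := eqVneq p 0.
    by rewrite p0' /kl mul0r sqrtr0 sub0r sqrrN sqr_sqrtr //; lra.
  have p1 : 0 < p by rewrite lt0r p0'.
  have q1 := pq p1.
  have s1 : 0 < Num.sqrt p by rewrite sqrtr_gt0.
  have u1 : 0 < Num.sqrt q by rewrite sqrtr_gt0.
  have hs : ln (p / q) = 2 * ln (Num.sqrt p / Num.sqrt q).
    rewrite -[in LHS](sqr_sqrtr p0) -[in LHS](sqr_sqrtr q0) -expr_div_n.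
    by rewrite lnXn ?divr_gt0// mulr_natl.
  have k2 : kl p q = 2 * Num.sqrt p * kl (Num.sqrt p) (Num.sqrt q).
    by rewrite /kl hs -{1}(sqr_sqrtr p0); ring.
  have := kl_ge (ltW s1) (ltW u1) (fun=> u1).
  rewrite -(@ler_pM2l _ (2 * Num.sqrt p)) ?mulr_gt0// -k2 => hk.
  have := sqr_sqrtr p0; have := sqr_sqrtr q0; nra.
have -> : p - q = (Num.sqrt p - Num.sqrt q) * (Num.sqrt p + Num.sqrt q).
  by rewrite -subr_sqr !sqr_sqrtr.
have h2 : (Num.sqrt p + Num.sqrt q) ^+ 2 <= 2 * (p + q).
  have := sqr_ge0 (Num.sqrt p - Num.sqrt q).
  have := sqr_sqrtr p0; have := sqr_sqrtr q0; nra.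
set s := Num.sqrt p in h h2 *; set u := Num.sqrt q in h h2 *.
apply: (@le_trans _ _ (t / 2 * (s - u) ^+ 2 + (s + u) ^+ 2 / (2 * t))).
  rewrite normrM.
  rewrite -(real_normK (num_real (s - u))) -(real_normK (num_real (s + u))).
  set a := `|s - u|; set b := `|s + u|.
  have : 0 <= (t * a - b) ^+ 2 / (2 * t).
    by rewrite divr_ge0 ?sqr_ge0 ?mulr_ge0 ?ltW.
  have -> : (t * a - b) ^+ 2 / (2 * t) = t / 2 * a ^+ 2 + b ^+ 2 / (2 * t) - a * b.
    by field; rewrite gt_eqF.
  lra.
apply: lerD.
  by rewrite ler_pM2l// divr_gt0.
have -> : (p + q) / t = 2 * (p + q) / (2 * t) by field; rewrite gt_eqF.
by rewrite ler_pM2r// invr_gt0 mulr_gt0.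
Qed.

(** On the tail the logarithm exceeds [tau]; off it, [kl_ge] makes the right side at least [p].
    Summed, this is a Markov bound on the tail mass. *)
Lemma kl_tail (R : realType) (p q tau : R) :
  0 <= p -> 0 <= q -> (0 < p -> 0 < q) ->
  tau * (if expR tau * q < p then p else 0) <= kl p q + q.
Proof.
move=> p0 q0 pq; case: ifPn => [h|_]; last first.
  by rewrite mulr0; have := kl_ge p0 q0 pq; lra.
have p1 : 0 < p by apply: le_lt_trans h; rewrite mulr_ge0 ?expR_ge0.
have q1 := pq p1.
suff : p * tau <= kl p q by lra.
rewrite /kl ler_pM2l// -[leLHS]expRK ler_ln ?posrE ?expR_gt0 ?divr_gt0//.
by rewrite ler_pdivlMr// ltW.
Qed.

(* Gibbs: [P ln (W / base) <= W - P + P ln K] pointwise. *)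
Lemma sum_kl_le (R : realType) (T : finType) (P W base : T -> R) (K : R) :
  (forall t, 0 <= P t) -> \sum_t P t = 1 ->
  (forall t, 0 <= W t) -> \sum_t W t <= 1 -> 0 < K ->
  (forall t, P t <= K * base t) -> (forall t, 0 < P t -> 0 < W t) ->
  \sum_t P t * ln (W t / base t) <= ln K.
Proof.
move=> P0 P1 W0 W1 K0 PK PW.
apply: (@le_trans _ _ (\sum_t (W t - P t + P t * ln K))).
  apply: ler_sum => t _.
  have [->|Pt] := eqVneq (P t) 0; first by rewrite !mul0r subr0 addr0.
  have Pt0 : 0 < P t by rewrite lt0r Pt P0.
  have Wt := PW _ Pt0.
  have b0 : 0 < base t by rewrite -(pmulr_rgt0 _ K0); apply: lt_le_trans (PK t).
  have h1 := kl_ge (P0 t) (W0 t) (PW t).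
  have : P t * ln (P t / base t) <= P t * ln K.
    by rewrite ler_pM2l// ler_ln ?posrE ?divr_gt0// ler_pdivrMr.
  move: h1; rewrite /kl !ln_div ?posrE// !mulrBr; lra.
rewrite big_split sumrB -mulr_suml P1 /=; lra.
Qed.

Lemma exists_le_sum (R : realType) (I : finType) (A : pred I) (F : I -> R) c :
  (0 < #|A|)%N -> \sum_(i in A) F i <= #|A|%:R * c ->
  exists2 i, i \in A & F i <= c.
Proof.
move=> A0 h; apply/exists_inP; apply: contraLR h; rewrite negb_exists_in.
move=> /forall_inP h; rewrite -ltNge mulr_natl -sumr_const.
have [i iA] := card_gt0P A0.
rewrite (bigD1 i)//= [ltRHS](bigD1 i)//=.
apply: ltr_leD; first by rewrite ltNge h.
by apply: ler_sum => j /andP[jA _]; rewrite ltW// ltNge h.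
Qed.

(** * Sequential sampling *)

Definition upd (k : nat) (A : finType) (w : {ffun 'I_k -> A}) (i : 'I_k) (a : A) :
  {ffun 'I_k -> A} := [ffun j => if j == i then a else w j].

Lemma sum_upd (R : realType) k (A : finType) (i : 'I_k) (F : {ffun 'I_k -> A} -> R) :
  \sum_w \sum_a F (upd w i a) = #|A|%:R * \sum_w F w.
Proof.
(* The involution swaps [a] with the value of [w] at [i]. *)
pose h (u : {ffun 'I_k -> A} * A) := (upd u.1 i u.2, u.1 i).
have hK : involutive h.
  move=> [w a]; rewrite /h /=; congr pair; last by rewrite ffunE eqxx.
  by apply/ffunP => j; rewrite !ffunE; case: eqP => // ->.
rewrite pair_bigA (reindex_inj (inv_inj hK)) /=.
rewrite -(pair_bigA _ (fun w a => F (upd (upd w i a) i (w i)))) /=.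
rewrite mulr_sumr; apply: eq_bigr => w _.
rewrite -sum1_card natr_sum mulr_suml; apply: eq_bigr => a _.
rewrite mul1r; congr F.
by apply/ffunP => j; rewrite !ffunE; case: eqP => // ->.
Qed.

(* [q] is a system of conditional distributions for drawing the coordinates of
   [w] one after the other, in the order of increasing rank. *)
Lemma sum_prod_kernels (R : realType) k (A : finType)
    (q : 'I_k -> {ffun 'I_k -> A} -> R) (rank : 'I_k -> nat) :
  (0 < #|A|)%N -> (forall i w, 0 <= q i w) ->
  (forall i w, \sum_a q i (upd w i a) <= 1) ->
  (forall i j w a, i != j -> (rank i <= rank j)%N -> q i (upd w j a) = q i w) ->
  \sum_w \prod_i q i w <= 1.
Proof.
move=> A0 q0 q1 qr.
(* Coordinates outside [S] range freely, hence the powers of [#|A|]. The coordinate of largest rank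
   in [S] is summed out first: no other kernel of [S] looks at it. *)
suff h : forall n (S : {set 'I_k}), #|S| = n ->
    #|A|%:R ^+ n * \sum_w \prod_(i in S) q i w <= #|A|%:R ^+ k.
  have := h k [set: 'I_k]%SET; rewrite cardsT card_ord => /(_ erefl).
  rewrite -ler_pdivlMl ?exprn_gt0 ?ltr0n// mulVf ?expf_neq0 ?pnatr_eq0 -?lt0n//.
  by under eq_bigr do under eq_bigl do rewrite inE.
elim=> [S /eqP|n IH S Sn].
  rewrite cards_eq0 => /eqP ->; rewrite expr0 mul1r.
  under eq_bigr do rewrite big_set0.
  by rewrite sumr_const card_ffun card_ord natrX.
have [i0 i0S] : exists i, i \in S by apply/card_gt0P; rewrite Sn.
case: (@arg_maxnP _ i0 (mem S) rank i0S) => i; rewrite -[mem S i]/(i \in S) => iS imax.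
have Si : #|S :\ i| = n by move: Sn; rewrite (cardsD1 i) iS add1n => -[].
apply: le_trans (IH _ Si); rewrite exprSr -mulrA ler_wpM2l ?exprn_ge0//.
rewrite -(sum_upd i); apply: ler_sum => w _.
have -> : \sum_a \prod_(j in S) q j (upd w i a) =
    \sum_a q i (upd w i a) * \prod_(j in S :\ i) q j w.
  apply: eq_bigr => a _; rewrite (big_setD1 i)//=; congr (_ * _).
  apply: eq_bigr => j; rewrite !inE => /andP[ji jS].
  by rewrite qr//; exact: imax.
by rewrite -mulr_suml ler_piMl ?prodr_ge0.
Qed.

(** * One coordinate *)

Section Marginals.
Variables (R : realType) (A B : finType).
Implicit Types (p q : {ffun A * B -> R}).

Lemma sum_marg1 p : \sum_a marg1 p a = \sum_t p t.
Proof.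
by rewrite pair_bigA; apply: eq_bigr => -[].
Qed.

Lemma sum_marg2 p : \sum_b marg2 p b = \sum_t p t.
Proof.
by rewrite exchange_big pair_bigA; apply: eq_bigr => -[].
Qed.

Lemma marg1_ge0 p a : (forall t, 0 <= p t) -> 0 <= marg1 p a.
Proof. by move=> p0; apply: sumr_ge0. Qed.

Lemma marg2_ge0 p b : (forall t, 0 <= p t) -> 0 <= marg2 p b.
Proof. by move=> p0; apply: sumr_ge0. Qed.

Lemma le_marg1 p a b : (forall t, 0 <= p t) -> p (a, b) <= marg1 p a.
Proof. by move=> p0; rewrite /marg1 (bigD1 b)//= lerDl sumr_ge0. Qed.

Lemma le_marg2 p a b : (forall t, 0 <= p t) -> p (a, b) <= marg2 p b.
Proof. by move=> p0; rewrite /marg2 (bigD1 a)//= lerDl sumr_ge0. Qed.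

Lemma cond21_ge0 p b a : (forall t, 0 <= p t) -> 0 <= cond21 p b a.
Proof. by move=> p0; rewrite divr_ge0 ?marg1_ge0. Qed.

Lemma cond12_ge0 p a b : (forall t, 0 <= p t) -> 0 <= cond12 p a b.
Proof. by move=> p0; rewrite divr_ge0 ?marg2_ge0. Qed.

Lemma cond21_gt0 p b a : (forall t, 0 <= p t) -> 0 < p (a, b) ->
  0 < cond21 p b a.
Proof. by move=> p0 pab; rewrite divr_gt0// (lt_le_trans pab) ?le_marg1. Qed.

Lemma cond12_gt0 p a b : (forall t, 0 <= p t) -> 0 < p (a, b) ->
  0 < cond12 p a b.
Proof. by move=> p0 pab; rewrite divr_gt0// (lt_le_trans pab) ?le_marg2. Qed.

Lemma marg1_cond21 p a b : (forall t, 0 <= p t) ->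
  marg1 p a * cond21 p b a = p (a, b).
Proof.
move=> p0; have [m0|m0] := eqVneq (marg1 p a) 0; last first.
  by rewrite mulrC divfK.
by apply/eqP; rewrite m0 mul0r eq_sym eq_le p0 -m0 le_marg1.
Qed.

Lemma marg2_cond12 p a b : (forall t, 0 <= p t) ->
  marg2 p b * cond12 p a b = p (a, b).
Proof.
move=> p0; have [m0|m0] := eqVneq (marg2 p b) 0; last first.
  by rewrite mulrC divfK.
by apply/eqP; rewrite m0 mul0r eq_sym eq_le p0 -m0 le_marg2.
Qed.

Lemma sum_cond21 p a : marg1 p a != 0 -> \sum_b cond21 p b a = 1.
Proof. by move=> m0; rewrite -mulr_suml divff. Qed.

Lemma sum_cond12 p b : marg2 p b != 0 -> \sum_a cond12 p a b = 1.
Proof. by move=> m0; rewrite -mulr_suml divff. Qed.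

Lemma sum_cond21_le1 p a : \sum_b cond21 p b a <= 1.
Proof.
have [m0|/sum_cond21 -> //] := eqVneq (marg1 p a) 0.
by rewrite big1// => b _; rewrite /cond21 m0 invr0 mulr0.
Qed.

Lemma sum_cond12_le1 p b : \sum_a cond12 p a b <= 1.
Proof.
have [m0|/sum_cond12 -> //] := eqVneq (marg2 p b) 0.
by rewrite big1// => a _; rewrite /cond12 m0 invr0 mulr0.
Qed.

End Marginals.

(** * Restoring the one-way condition *)

Section SingleCoordinate.
Variables (R : realType) (X Y Z : finType) (f : {set X * Y * Z}).
Variables (mu : {ffun X * Y -> R}).
Hypothesis mu_ge0 : forall u, 0 <= mu u.

(** Repairs [p] into a law that is one-way for [mu], up to normalisation; the law of [x] is kept and
    [y] is redrawn. *)
Definition resample (p : {ffun X * Y -> R}) : {ffun X * Y -> R} :=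
  [ffun u => marg1 p u.1 * cond21 mu u.2 u.1].

Section Resample.
Variable p : {ffun X * Y -> R}.
Hypotheses (p_ge0 : forall u, 0 <= p u) (p_mu : forall u, 0 < p u -> 0 < mu u).

Lemma resample_ge0 u : 0 <= resample p u.
Proof. by rewrite ffunE mulr_ge0 ?marg1_ge0 ?cond21_ge0. Qed.

Lemma resample_gt0 u : 0 < p u -> 0 < resample p u.
Proof.
case: u => a b pu; rewrite ffunE mulr_gt0 ?cond21_gt0 ?p_mu//.
exact: lt_le_trans pu (le_marg1 _ _ p_ge0).
Qed.

Lemma marg1_resample a : marg1 (resample p) a = marg1 p a.
Proof.
rewrite /marg1; under eq_bigr do rewrite ffunE /=.
rewrite -mulr_sumr -/(marg1 p a).
have [->|m0] := eqVneq (marg1 p a) 0; first by rewrite mul0r.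
(* Where [marg1 mu a] vanishes, so does [mu], and hence [p], on the whole row of [a]. *)
rewrite sum_cond21 ?mulr1//; apply: contraNneq m0 => m0.
rewrite /marg1 big1// => b _; apply/eqP; rewrite eq_le p_ge0 andbT leNgt.
apply/negP => /p_mu; rewrite ltNge => /negP; apply.
by rewrite -m0 le_marg1.
Qed.

Lemma sum_resample : \sum_u resample p u = \sum_u p u.
Proof.
by rewrite -!sum_marg1; apply: eq_bigr => a _; rewrite marg1_resample.
Qed.

Lemma sum_marg2_cond12_le :
  \sum_(u : X * Y) marg2 p u.2 * cond12 mu u.1 u.2 <= \sum_u p u.
Proof.
rewrite -sum_marg2 -(pair_bigA _ (fun a b => marg2 p b * cond12 mu a b)) /=.
rewrite exchange_big; apply: ler_sum => b _ /=.
by rewrite -mulr_sumr ler_piMr ?marg2_ge0 ?sum_cond12_le1.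
Qed.

End Resample.

(* Outside a set of [resample p]-mass bounded by the [L1] distance,
   [resample p <= 2 p] and [marg2 p <= 2 marg2 (resample p)]: hence the 4. *)
Lemma resample_tail (p : {ffun X * Y -> R}) (K : R) :
  (forall u, 0 <= p u) -> (forall u, 0 < p u -> 0 < mu u) -> 0 <= K ->
  \sum_(u | K * 4 * cond12 mu u.1 u.2 < cond12 (resample p) u.1 u.2)
     resample p u <=
  4 * (\sum_u `|p u - resample p u|) +
  \sum_(u | K * (marg2 p u.2 * cond12 mu u.1 u.2) < p u) p u.
Proof.
move=> p0 pmu K0; set q := resample p.
have q0 u : 0 <= q u by exact: resample_ge0.
pose D := \sum_u `|p u - q u|.
(* In such a column [marg2 q] is below [marg2 p - marg2 q], hence below the [L1] distance within the
   column. *)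
have hD2 : \sum_(u | 2 * marg2 q u.2 < marg2 p u.2) q u <= D.
  pose c b := 2 * marg2 q b < marg2 p b.
  rewrite big_mkcond (eq_bigr (fun u => if c u.2 then q (u.1, u.2) else 0));
    last by case.
  rewrite -(pair_bigA _ (fun a b => if c b then q (a, b) else 0)) /=.
  rewrite exchange_big /=.
  have -> : D = \sum_b \sum_a `|p (a, b) - q (a, b)|.
    by rewrite exchange_big pair_bigA; apply: eq_bigr => -[].
  apply: ler_sum => b _; have [hb|_] := boolP (c b).
    apply: (@le_trans _ _ `|marg2 p b - marg2 q b|).
      rewrite -/(marg2 q b); move: hb; rewrite /c.
      have := ler_norm (marg2 p b - marg2 q b).
      have := marg2_ge0 b q0; lra.
    by rewrite /marg2 -sumrB; apply: ler_norm_sum.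
  by rewrite big1 ?sumr_ge0.
have -> : 4 * D = 2 * D + D + D by ring.
(* If [q > 2 p], the first term exceeds [q]. If [q <= 2 p] and neither exceptional event occurs, the
   tail condition itself fails. *)
apply: (@le_trans _ _ (\sum_u (2 * `|p u - q u| +
   (if 2 * marg2 q u.2 < marg2 p u.2 then q u else 0) +
   (if K * (marg2 p u.2 * cond12 mu u.1 u.2) < p u then p u else 0)))).
  rewrite big_mkcond; apply: ler_sum => -[a b] _ /=.
  have d0 : 0 <= `|p (a, b) - q (a, b)| by [].
  have d1 := ler_norm (p (a, b) - q (a, b)).
  have d2 : q (a, b) - p (a, b) <= `|p (a, b) - q (a, b)|.
    by rewrite distrC ler_norm.
  have pab := p0 (a, b); have qab := q0 (a, b).
  case: ifPn => h; last by do 2 case: ifP => _; lra.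
  case: ifPn => h2; first by case: ifP => _; lra.
  case: ifPn => h3; first by lra.
  have [q1|q1] := ltP (2 * p (a, b)) (q (a, b)); first by lra.
  have [z|qz] := eqVneq (q (a, b)) 0; first by lra.
  have qp : 0 < q (a, b) by rewrite lt0r qz.
  have m0 : 0 < marg2 q b by apply: lt_le_trans qp (le_marg2 _ _ _).
  rewrite /cond12 -/(cond12 mu a b) ltr_pdivlMr // in h.
  rewrite -leNgt in h2; rewrite -leNgt in h3.
  have c0 := cond12_ge0 a b mu_ge0.
  have : K * cond12 mu a b * marg2 p b <= K * cond12 mu a b * (2 * marg2 q b).
    by rewrite ler_wpM2l// mulr_ge0.
  lra.
rewrite !big_split /= -mulr_sumr -!big_mkcond /=.
have : 0 <= D by apply: sumr_ge0.
rewrite -/D; lra.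
Qed.

(** The hypothesis bounds the total over all cells of the answer error, four times the [L1] cost of
    resampling, and the tail mass. Some cell of positive mass meets the bound relative to its mass;
    resampled and normalised, it is the witness. *)
Lemma exists_one_way (Rho : finType) (J : Rho -> {ffun X * Y -> R})
    (G : Rho -> {ffun Y -> Z}) (eps t tau : R) :
  (forall r u, 0 <= J r u) -> \sum_r \sum_u J r u = 1 ->
  (forall r u, 0 < J r u -> 0 < mu u) -> 0 < t -> 0 < tau ->
  \sum_r \sum_(u | (u.1, u.2, G r u.2) \notin f) J r u +
  4 * (t / 2 * (\sum_r \sum_u kl (J r u) (resample (J r) u)) + 2 / t) +
  (\sum_r \sum_u kl (J r u) (marg2 (J r) u.2 * cond12 mu u.1 u.2) + 1) / tau
    <= eps ->
  exists l : {ffun X * Y -> R}, [/\ is_dist l, one_way mu l, err f l <= eps &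
    \sum_(u | expR tau * 4 * cond12 mu u.1 u.2 < cond12 l u.1 u.2) l u <= eps].
Proof.
move=> J0 J1 Jmu t0 tau0 Heps.
pose N r := \sum_u J r u.
pose E r := \sum_(u | (u.1, u.2, G r u.2) \notin f) J r u.
pose D r := \sum_u `|J r u - resample (J r) u|.
pose B r := \sum_(u | expR tau * (marg2 (J r) u.2 * cond12 mu u.1 u.2) < J r u)
   J r u.
have N0 r : 0 <= N r by apply: sumr_ge0.
have hD : \sum_r D r <=
    t / 2 * (\sum_r \sum_u kl (J r u) (resample (J r) u)) + 2 / t.
  apply: (@le_trans _ _ (\sum_r (t / 2 * (\sum_u kl (J r u) (resample (J r) u))
     + 2 / t * N r))).
    apply: ler_sum => r _.
    have := @ler_sum _ _ (index_enum _) xpredT _ _ (fun u _ => dist_le_kl (J0 r u)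
      (resample_ge0 (J0 r) u) (@resample_gt0 _ (J0 r) (Jmu r) u) t0).
    rewrite -/(D r) big_split /= -mulr_sumr -mulr_suml !big_split /= sumrN.
    (* Resampling preserves mass, so the linear terms of [dist_le_kl] cancel. *)
    rewrite (sum_resample (J0 r) (Jmu r)) -/(N r) => h; apply: le_trans h _.
    by rewrite subrK [X in _ + X](_ : _ = 2 / t * N r)//; ring.
  by rewrite big_split /= -!mulr_sumr J1 mulr1.
have hB : \sum_r B r <= (\sum_r \sum_u kl (J r u)
    (marg2 (J r) u.2 * cond12 mu u.1 u.2) + 1) / tau.
  rewrite ler_pdivlMr// mulrC mulr_sumr -J1 -big_split /=.
  apply: ler_sum => r _.
  rewrite /B big_mkcond mulr_sumr.
  apply: le_trans (lerD (lexx _) (sum_marg2_cond12_le (J0 r))).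
  rewrite -big_split /=; apply: ler_sum => -[a b] _ /=.
  apply: kl_tail => //; first by rewrite mulr_ge0 ?marg2_ge0 ?cond12_ge0.
  move=> Jab; rewrite mulr_gt0 ?cond12_gt0 ?(Jmu r)//.
  exact: lt_le_trans Jab (le_marg2 _ _ (J0 r)).
have E0 r : 0 <= E r by apply: sumr_ge0.
have D0 r : 0 <= D r by apply: sumr_ge0.
have B0 r : 0 <= B r by apply: sumr_ge0.
have [r [Nr Hr]] : exists r, 0 < N r /\ E r + 4 * D r + B r <= eps * N r.
  (* Otherwise the differences are nonnegative with sum at most 0, so all vanish, and a cell of
     positive mass meets the bound after all. *)
  apply: contrapT => /forallNP h.
  have hge r : 0 <= E r + 4 * D r + B r - eps * N r.
    have [Nr|] := ltP 0 (N r).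
      have := h r; rewrite not_andP => -[//|/negP].
      by rewrite -ltNge => /ltW; rewrite subr_ge0.
    move=> Nr; have -> : N r = 0 by apply/eqP; rewrite eq_le Nr N0.
    by rewrite mulr0 subr0 !addr_ge0// mulr_ge0.
  have : \sum_r (E r + 4 * D r + B r - eps * N r) <= 0.
    rewrite sumrB -mulr_sumr J1 2!big_split /= -mulr_sumr.
    rewrite -/(\sum_r E r) in Heps; lra.
  rewrite le_eqVlt ltNge sumr_ge0// orbF psumr_eq0// => /allP h0.
  have [r Nr] : exists r, 0 < N r.
    apply: contrapT => /forallNP hN; have : \sum_r N r = 0.
      apply: big1 => r _; apply/eqP; rewrite eq_le N0 andbT leNgt.
      exact/negP/hN.
    by rewrite J1 => /eqP; rewrite oner_eq0.
  apply: (h r); split=> //.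
  by have := h0 r (mem_index_enum _); rewrite subr_eq0 => /eqP ->.
have J0r := J0 r; have Jmur := Jmu r.
pose q := resample (J r).
have q0 u : 0 <= q u by exact: resample_ge0.
pose l : {ffun X * Y -> R} := [ffun u => q u / N r].
have lE u : l u = q u / N r by rewrite ffunE.
have m1 a : marg1 l a = marg1 (J r) a / N r.
  rewrite -(marg1_resample J0r Jmur a) /marg1 mulr_suml.
  by apply: eq_bigr => b _; rewrite lE.
have m2 b : marg2 l b = marg2 q b / N r.
  by rewrite /marg2 mulr_suml; apply: eq_bigr => a _; rewrite lE.
have c12 a b : cond12 l a b = cond12 q a b.
  by rewrite /cond12 m2 lE invfM invrK mulrACA mulVf ?mulr1 ?gt_eqF.
exists l; split.
- split=> [u|]; first by rewrite lE divr_ge0.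
  under eq_bigr do rewrite lE.
  by rewrite -mulr_suml sum_resample// divff ?gt_eqF.
- move=> a b; rewrite lE pmulr_lgt0 ?invr_gt0// => qab.
  rewrite {2}/cond21 lE m1 /q ffunE /= invfM invrK.
  rewrite mulrACA mulVf ?mulr1 ?gt_eqF// mulrAC divff ?mul1r//.
  by apply: contraTneq qab => m0; rewrite /q ffunE /= m0 mul0r ltxx.
- apply: le_trans (bigmin_le _ (G r) _) _; rewrite /prob.
  under eq_bigr do rewrite lE.
  rewrite -mulr_suml ler_pdivrMr//.
  apply: le_trans Hr.
  apply: (@le_trans _ _ (E r + D r)); last by have := D0 r; have := B0 r; lra.
  apply: (@le_trans _ _ (E r + \sum_(u | (u.1, u.2, G r u.2) \notin f)
     `|J r u - q u|)).
    rewrite /E -big_split /=; apply: ler_sum => u _.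
    by rewrite distrC; have := ler_norm (q u - J r u); lra.
  by rewrite lerD2l /D [leRHS](bigID (fun u => (u.1, u.2, G r u.2) \notin f))
    /= lerDl sumr_ge0.
- under eq_bigl do rewrite c12.
  under eq_bigr do rewrite lE.
  rewrite -mulr_suml ler_pdivrMr//.
  apply: le_trans Hr; apply: le_trans (resample_tail J0r Jmur (expR_ge0 _)) _.
  by rewrite -/(D r) -/(B r); have := E0 r; lra.
Qed.

End SingleCoordinate.

(** * Chain rules *)

(** Off the support of [l] the conditional [l(b|a)] is 0, so [nu(b|a)] dominates it everywhere; both
    have mass at most 1 and [l(.|a)] has mass 1, which forces equality. *)
Lemma one_way_prod (R : realType) (A B : finType) (nu l : {ffun A * B -> R}) :
  (forall t, 0 <= nu t) -> (forall t, 0 <= l t) -> one_way nu l ->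
  forall a b, l (a, b) = marg1 l a * cond21 nu b a.
Proof.
move=> nu0 l0 h a b.
have [m0|m0] := eqVneq (marg1 l a) 0.
  by apply/eqP; rewrite m0 mul0r eq_le l0 -m0 le_marg1.
rewrite -[LHS](marg1_cond21 a b l0); congr (_ * _).
have ge b' : 0 <= cond21 nu b' a - cond21 l b' a.
  have [lb|lb] := ltP 0 (l (a, b')); first by rewrite h// subrr.
  have -> : cond21 l b' a = 0.
    by rewrite /cond21 (_ : l _ = 0) ?mul0r//; apply/eqP; rewrite eq_le lb l0.
  by rewrite subr0 cond21_ge0.
have : \sum_b' (cond21 nu b' a - cond21 l b' a) <= 0.
  by rewrite sumrB (sum_cond21 m0) subr_le0 sum_cond21_le1.
rewrite le_eqVlt ltNge sumr_ge0// orbF psumr_eq0// => /allP/(_ b).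
by rewrite mem_index_enum subr_eq0 => /(_ isT)/eqP.
Qed.

(** * Product distributions *)

Section Powers.
Variables (R : realType) (X Y : finType) (mu : {ffun X * Y -> R}) (k : nat).
Hypothesis mu_dist : is_dist mu.

Let mu_ge0 : forall u, 0 <= mu u := mu_dist.1.

Lemma dist_pow_ge0 t : 0 <= dist_pow mu k t.
Proof. by rewrite ffunE prodr_ge0. Qed.

Lemma marg1_dist_pow x : marg1 (dist_pow mu k) x = \prod_i marg1 mu (x i).
Proof.
by rewrite /marg1 bigA_distr_bigA; apply: eq_bigr => y _; rewrite ffunE.
Qed.

Lemma marg2_dist_pow y : marg2 (dist_pow mu k) y = \prod_i marg2 mu (y i).
Proof.
by rewrite /marg2 bigA_distr_bigA; apply: eq_bigr => x _; rewrite ffunE.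
Qed.

Lemma cond21_dist_pow y x :
  cond21 (dist_pow mu k) y x = \prod_i cond21 mu (y i) (x i).
Proof. by rewrite /cond21 marg1_dist_pow ffunE -prodf_div. Qed.

Lemma sum_prod_marg2 : \sum_(y : {ffun 'I_k -> Y}) \prod_i marg2 mu (y i) = 1.
Proof.
rewrite -(bigA_distr_bigA (fun (i : 'I_k) b => marg2 mu b)).
by rewrite big1// => i _; rewrite sum_marg2 mu_dist.2.
Qed.

Lemma sum_dist_pow : \sum_t dist_pow mu k t = 1.
Proof.
rewrite -sum_marg2 -sum_prod_marg2.
by apply: eq_bigr => y _; rewrite marg2_dist_pow.
Qed.

End Powers.

(** * Revealing coordinates one after the other *)

Section Chain.
Variables (R : realType) (X Y Z : finType) (f : {set X * Y * Z}).
Variables (mu : {ffun X * Y -> R}) (k : nat) (C : {set 'I_k}).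
Hypothesis mu_dist : is_dist mu.

Let mu_ge0 : forall u, 0 <= mu u := mu_dist.1.

Notation Xk := {ffun 'I_k -> X}.
Notation Yk := {ffun 'I_k -> Y}.

(* The coordinates in [C] come first, then the others in increasing order;
   [cell j] reveals [x_i] for [i] before [j] and [y_i] for [i] after [j]. *)
Definition before (j i : 'I_k) := (i \in C) || (i < j)%N.
Definition after (j i : 'I_k) := (i \notin C) && (j < i)%N.

Definition cellx j (x : Xk) : {ffun 'I_k -> option X} :=
  [ffun i => if before j i then Some (x i) else None].
Definition celly j (y : Yk) : {ffun 'I_k -> option Y} :=
  [ffun i => if after j i then Some (y i) else None].
Definition cell j (t : Xk * Yk) := (cellx j t.1, celly j t.2).
Definition coord (j : 'I_k) (t : Xk * Yk) := (t.1 j, t.2 j).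

Lemma cellx_upd j i x a : ~~ before j i -> cellx j (upd x i a) = cellx j x.
Proof.
move=> ji; apply/ffunP => i'; rewrite !ffunE.
by case: eqP => // ->; rewrite (negbTE ji).
Qed.

Lemma celly_upd j i y b : ~~ after j i -> celly j (upd y i b) = celly j y.
Proof.
move=> ji; apply/ffunP => i'; rewrite !ffunE.
by case: eqP => // ->; rewrite (negbTE ji).
Qed.

Variable P : Xk * Yk -> R.
Hypotheses (P_ge0 : forall t, 0 <= P t) (P_sum : \sum_t P t = 1).

(** Unnormalised: the mass of [law j r] is the probability of the cell [r], so sums over cells need
    no weights. *)
Definition law j r : {ffun X * Y -> R} :=
  [ffun u => \sum_(t | (cell j t, coord j t) == (r, u)) P t].

Lemma law_ge0 j r u : 0 <= law j r u.
Proof. by rewrite ffunE sumr_ge0. Qed.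

Lemma le_law j t : P t <= law j (cell j t) (coord j t).
Proof. by rewrite ffunE (bigD1 t)//= lerDl sumr_ge0. Qed.

Lemma sum_law j F :
  \sum_r \sum_u law j r u * F r u = \sum_t P t * F (cell j t) (coord j t).
Proof.
rewrite pair_bigA [RHS](partition_big (fun t => (cell j t, coord j t)) xpredT)//.
apply: eq_bigr => -[r u] _; rewrite ffunE mulr_suml.
by apply: eq_bigr => t /eqP [-> ->].
Qed.

Lemma sum_law1 j : \sum_r \sum_u law j r u = 1.
Proof.
transitivity (\sum_t P t * 1); last by under eq_bigr do rewrite mulr1.
rewrite -(sum_law j (fun _ _ => 1)).
by apply: eq_bigr => r _; apply: eq_bigr => u _; rewrite mulr1.
Qed.

Lemma law_gt0 j r u : 0 < law j r u ->
  exists2 t, 0 < P t & coord j t = u.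
Proof.
rewrite ffunE => h; apply: contrapT => /forall2NP H; move: h.
rewrite big1 ?ltxx// => t /eqP[_ tu]; apply/eqP; rewrite eq_le P_ge0 andbT.
by rewrite leNgt; apply/negP => Pt; have [] := H t.
Qed.

(** The product of the ratios reweights [base] into some [W] of mass at most 1; the sum of the
    logarithms is then [ln (W / base)], and Gibbs applies. *)
Lemma sum_ln_chain (base : Xk * Yk -> R) (c m : 'I_k -> Xk * Yk -> R) (K : R) :
  0 < K -> (forall t, P t <= K * base t) -> (forall t, 0 <= base t) ->
  (forall j t, 0 <= c j t) -> (forall j t, 0 <= m j t) ->
  (forall j t, 0 < P t -> 0 < c j t) -> (forall j t, 0 < P t -> 0 < m j t) ->
  \sum_t base t * \prod_(j | j \notin C) (c j t / m j t) <= 1 ->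
  \sum_(j | j \notin C) \sum_t P t * ln (c j t / m j t) <= ln K.
Proof.
move=> K0 PK b0 c0 m0 Pc Pm W1.
apply: le_trans (sum_kl_le P_ge0 P_sum _ W1 K0 PK _).
- rewrite exchange_big; apply: ler_sum => t _.
  have [->|Pt] := eqVneq (P t) 0.
    by rewrite mul0r big1// => j _; rewrite mul0r.
  have {}Pt : 0 < P t by rewrite lt0r Pt P_ge0.
  have b1 : 0 < base t by rewrite -(pmulr_rgt0 _ K0); apply: lt_le_trans (PK t).
  rewrite -mulr_sumr mulrAC divff ?gt_eqF// mul1r ln_prod// => j _.
  by rewrite divr_gt0 ?Pc ?Pm.
- by move=> t; rewrite mulr_ge0// prodr_ge0// => j _; rewrite divr_ge0.
- move=> t Pt; rewrite mulr_gt0//.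
    by rewrite -(pmulr_rgt0 _ K0); apply: lt_le_trans (PK t).
  by rewrite prodr_gt0// => j _; rewrite divr_gt0 ?Pc ?Pm.
Qed.

Lemma mulr_div_le (c m : R) : 0 <= c -> m * (c / m) <= c.
Proof.
move=> c0; have [->|m0] := eqVneq m 0; first by rewrite mul0r.
by rewrite mulrC divfK.
Qed.

(** Outside [C] each factor [m j] is traded for [c j]; equality can fail only where [m j = 0]. *)
Lemma prod_ratio_le (c m : 'I_k -> R) :
  (forall j, 0 <= c j) -> (forall j, 0 <= m j) ->
  \prod_j m j * \prod_(j | j \notin C) (c j / m j) <=
  \prod_j (if j \in C then m j else c j).
Proof.
move=> c0 m0; rewrite (bigID (fun j => j \in C)) /= -mulrA -big_split /=.
rewrite [leRHS](bigID (fun j => j \in C)) /=.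
apply: ler_pM.
- exact: prodr_ge0.
- by apply: prodr_ge0 => j _; rewrite mulr_ge0// divr_ge0.
- by rewrite le_eqVlt; apply/orP; left; apply/eqP/eq_bigr => j ->.
- apply: ler_prod => j /negbTE ->.
  by rewrite mulr_div_le// andbT mulr_ge0// divr_ge0.
Qed.

(** For fixed [y], reweighting turns [mu^k] into a sequential draw of [x]: from [mu] on [C], from
    the laws elsewhere. *)
Lemma sum_kl_law_x (K : R) : 0 < K ->
  (forall t, P t <= K * dist_pow mu k t) ->
  \sum_(j | j \notin C) \sum_r \sum_u
    kl (law j r u) (marg2 (law j r) u.2 * cond12 mu u.1 u.2) <= ln K.
Proof.
move=> K0 PK.
pose c j (t : Xk * Yk) := cond12 (law j (cell j t)) (t.1 j) (t.2 j).
pose m j (t : Xk * Yk) := cond12 mu (t.1 j) (t.2 j).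
have mu_gt0 j t : 0 < P t -> 0 < mu (t.1 j, t.2 j).
  move=> Pt; rewrite lt0r mu_ge0 andbT; apply: contraTneq (PK t) => h.
  by rewrite ffunE (bigD1 j)//= h mul0r mulr0 -ltNge.
rewrite (eq_bigr (fun j => \sum_t P t * ln (c j t / m j t))) => [|j _].
  apply: (sum_ln_chain K0 PK) => [|j t|j t|j t Pt|j t Pt|].
  - exact: dist_pow_ge0.
  - exact/cond12_ge0/law_ge0.
  - exact: cond12_ge0.
  - by apply: cond12_gt0 (law_ge0 _ _) _; apply: lt_le_trans Pt (le_law j t).
  - exact/cond12_gt0/mu_gt0.
  have A0 : (0 < #|X|)%N.
    by apply/card_gt0P; have [u _] := support_nonempty mu_dist.2; exists u.1.
  pose q y j (x : Xk) := if j \in C then m j (x, y) else c j (x, y).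
  have hW : \sum_t dist_pow mu k t * \prod_(j | j \notin C) (c j t / m j t) <=
      \sum_(y : Yk) ((\prod_i marg2 mu (y i)) * \sum_x \prod_j q y j x).
    rewrite (eq_bigr (fun t => dist_pow mu k (t.1, t.2) *
      \prod_(j | j \notin C) (c j (t.1, t.2) / m j (t.1, t.2)))); last by case.
    rewrite -(pair_bigA _ (fun x y => dist_pow mu k (x, y) *
      \prod_(j | j \notin C) (c j (x, y) / m j (x, y)))) /= exchange_big /=.
    apply: ler_sum => y _; rewrite mulr_sumr; apply: ler_sum => x _.
    rewrite ffunE.
    rewrite (eq_bigr (fun i => marg2 mu (y i) * cond12 mu (x i) (y i))); last first.
      by move=> i _; rewrite marg2_cond12.
    rewrite big_split /= -mulrA ler_wpM2l ?prodr_ge0// => [i _|].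
      exact: marg2_ge0.
    apply: (prod_ratio_le (c := c^~ (x, y)) (m := m^~ (x, y))) => j.
      exact/cond12_ge0/law_ge0.
    exact: cond12_ge0.
  apply: (le_trans hW); rewrite -[leRHS](sum_prod_marg2 k mu_dist); apply: ler_sum => y _.
  rewrite ler_piMr ?prodr_ge0// => [i _|]; first exact: marg2_ge0.
  (* [C] comes first, then increasing order: besides [x_i], the kernel at [i] reads only [x] at
     earlier coordinates. *)
  apply: (sum_prod_kernels (rank := fun i => if i \in C then 0 else i.+1)) => //.
  - move=> i x; rewrite /q; case: ifP => _; first exact: cond12_ge0.
    exact/cond12_ge0/law_ge0.
  - move=> i x; rewrite /q; have [iC|iC] := boolP (i \in C).
      under eq_bigr do rewrite /m ffunE eqxx.
      exact: sum_cond12_le1.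
    under eq_bigr do rewrite /c /cell /= cellx_upd ?/before ?(negbTE iC) ?ltnn
      ?andbF// ffunE eqxx.
    exact: sum_cond12_le1.
  - move=> i j x a ij; rewrite /q; case: ifP => iC.
      by rewrite /m ffunE (negbTE ij).
    case: ifP => // jC ilej.
    by rewrite /c /cell /= cellx_upd ?ffunE ?(negbTE ij)// /before jC -leqNgt.
rewrite -(sum_law j (fun r u => ln (cond12 (law j r) u.1 u.2 / cond12 mu u.1 u.2))).
apply: eq_bigr => r _; apply: eq_bigr => -[v w] _.
by rewrite /kl /cond12 [X in _ = _ * ln X]mulrAC -mulrA -invfM [X in _ / X]mulrC
  ?mulrA.
Qed.

(** The dual draw, of [y] given [x]. With [a] the true law of [x], [K] need only account for the
    conditioning. *)
Lemma sum_kl_law_y (a : Xk -> R) (K : R) : 0 < K ->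
  (forall x, 0 <= a x) -> \sum_x a x <= 1 ->
  (forall t, P t <= K * (a t.1 * \prod_j cond21 mu (t.2 j) (t.1 j))) ->
  \sum_(j | j \notin C) \sum_r \sum_u
    kl (law j r u) (resample mu (law j r) u) <= ln K.
Proof.
move=> K0 a0 a1 PK.
pose c j (t : Xk * Yk) := cond21 (law j (cell j t)) (t.2 j) (t.1 j).
pose m j (t : Xk * Yk) := cond21 mu (t.2 j) (t.1 j).
rewrite (eq_bigr (fun j => \sum_t P t * ln (c j t / m j t))) => [|j _].
  apply: (sum_ln_chain K0 PK) => [t|j t|j t|j t Pt|j t Pt|].
  - by rewrite mulr_ge0// prodr_ge0// => j _; rewrite cond21_ge0.
  - exact/cond21_ge0/law_ge0.
  - exact: cond21_ge0.
  - by apply: cond21_gt0 (law_ge0 _ _) _; apply: lt_le_trans Pt (le_law j t).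
  - rewrite lt0r cond21_ge0// andbT; apply: contraTneq (PK t) => h.
    by rewrite (bigD1 j)//= -/(m j t) h mul0r !mulr0 -ltNge.
  have B0 : (0 < #|Y|)%N.
    by apply/card_gt0P; have [u _] := support_nonempty mu_dist.2; exists u.2.
  pose q x j (y : Yk) := if j \in C then m j (x, y) else c j (x, y).
  have hW : \sum_t a t.1 * (\prod_j m j t) *
      \prod_(j | j \notin C) (c j t / m j t) <=
      \sum_x a x * \sum_y \prod_j q x j y.
    pose F x y := a x * \prod_j m j (x, y) *
      \prod_(j | j \notin C) (c j (x, y) / m j (x, y)).
    rewrite (eq_bigr (fun t => F t.1 t.2)); last by case.
    rewrite -(pair_bigA _ F) /=.
    apply: ler_sum => x _; rewrite mulr_sumr; apply: ler_sum => y _.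
    rewrite /F -mulrA ler_wpM2l//.
    apply: (prod_ratio_le (c := c^~ (x, y)) (m := m^~ (x, y))) => j.
      exact/cond21_ge0/law_ge0.
    exact: cond21_ge0.
  apply: (le_trans hW); apply: le_trans a1; apply: ler_sum => x _; rewrite ler_piMr//.
  (* The order is reversed: cells reveal [y_i] only for later [i] outside [C], so [C] is drawn
     last. *)
  apply: (sum_prod_kernels (rank := fun i => if i \in C then k.+1 else (k - i)%N))
    => //.
  - move=> i y; rewrite /q; case: ifP => _; first exact: cond21_ge0.
    exact/cond21_ge0/law_ge0.
  - move=> i y; rewrite /q; have [iC|iC] := boolP (i \in C).
      under eq_bigr do rewrite /m ffunE eqxx.
      exact: sum_cond21_le1.
    under eq_bigr do rewrite /c /cell /= celly_upd ?/after ?(negbTE iC) ?ltnn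
      ?andbF// ffunE eqxx.
    exact: sum_cond21_le1.
  - move=> i j y b ij; rewrite /q; case: ifP => iC.
      by rewrite /m ffunE (negbTE ij).
    move=> h; rewrite /c /cell /= celly_upd ?ffunE ?(negbTE ij)// /after.
    move: h; case: ifP => //= jC.
    by rewrite -leqNgt leq_sub2lE// ltnW.
rewrite -(sum_law j (fun r u => ln (cond21 (law j r) u.2 u.1 / cond21 mu u.2 u.1))).
apply: eq_bigr => r _; apply: eq_bigr => -[v w] _.
have -> : resample mu (law j r) (v, w) = marg1 (law j r) v * cond21 mu w v.
  by rewrite /resample ffunE.
by rewrite /kl /cond21 [X in _ = _ * ln X]mulrAC -mulrA -invfM [X in _ / X]mulrC
  ?mulrA.
Qed.

End Chain.

(** * Conditioning on success *)

(* Once [x_C], the [x_i] before [j] and the [y_i] after [j] are fixed, [P] is a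
   product of a function of [x] and a function of [y] on the event [y_j = w], so
   some fixed answer does at least as well as [g y j]. *)
Lemma best_answer (R : realType) (X Y Z : finType) (f : {set X * Y * Z}) (k : nat)
    (C : {set 'I_k}) (P : {ffun 'I_k -> X} * {ffun 'I_k -> Y} -> R)
    (alpha : {ffun 'I_k -> X} -> R)
    (beta : {ffun 'I_k -> X} -> {ffun 'I_k -> Y} -> R) (m : X -> Y -> R)
    (g : {ffun 'I_k -> Y} -> {ffun 'I_k -> Z}) (j : 'I_k) (z0 : Z) :
  (forall x y, 0 <= beta x y) -> (forall v w, 0 <= m v w) ->
  (forall x y, P (x, y) = alpha x * beta x y * \prod_i m (x i) (y i)) ->
  (forall x x' y, cellx C j x = cellx C j x' -> beta x y = beta x' y) ->
  j \notin C ->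
  exists G : _ -> {ffun Y -> Z},
    \sum_r \sum_(u | (u.1, u.2, G r u.2) \notin f) law C P j r u <=
    \sum_(t : {ffun 'I_k -> X} * {ffun 'I_k -> Y} |
      (t.1 j, t.2 j, g t.2 j) \notin f) P t.
Proof.
move=> beta0 m0 PE betaC jC.
pose bad v w z : R := ((v, w, z) \notin f)%:R.
pose fib (r : {ffun 'I_k -> option X} * {ffun 'I_k -> option Y}) w
  (t : {ffun 'I_k -> X} * {ffun 'I_k -> Y}) := (cell C j t == r) && (t.2 j == w).
have best rw : exists z, \sum_(t | fib rw.1 rw.2 t) P t * bad (t.1 j) rw.2 z <=
    \sum_(t | fib rw.1 rw.2 t) P t * bad (t.1 j) rw.2 (g t.2 j).
  case: rw => r w /=.
  (* On an empty fibre any answer will do. Otherwise [(x0, y0)] supplies all the revealed values. *)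
  case: (pickP (fib r w)) => [[x0 y0] /andP[/eqP r0 /= w0]|h]; last first.
    by exists z0; rewrite !big_pred0.
  pose FX x := cellx C j x == r.1; pose FY y := (celly C j y == r.2) && (y j == w).
  pose U x := alpha x * \prod_(i | ~~ before C j i) m (x i) (y0 i).
  pose V y := beta x0 y * \prod_(i | before C j i) m (x0 i) (y i).
  pose E z := \sum_(x | FX x) U x * bad (x j) w z.
  have FX0 : FX x0 by rewrite /FX -r0.
  have FY0 : FY y0 by rewrite /FY -r0 /= eqxx.
  have PUV x y : FX x -> FY y -> P (x, y) = U x * V y.
    move=> xr /andP[yr yw]; rewrite PE (betaC x x0); last first.
      by rewrite (eqP xr) (eqP FX0).
    rewrite (bigID (before C j)) /= /U /V.
    have -> : \prod_(i | before C j i) m (x i) (y i) =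
        \prod_(i | before C j i) m (x0 i) (y i).
      apply: eq_bigr => i bi.
      have /ffunP/(_ i) : cellx C j x = cellx C j x0 by rewrite (eqP xr) (eqP FX0).
      by rewrite !ffunE bi => -[->].
    have -> : \prod_(i | ~~ before C j i) m (x i) (y i) =
        \prod_(i | ~~ before C j i) m (x i) (y0 i).
      apply: eq_bigr => i bi.
      have [->|ij] := eqVneq i j; first by rewrite (eqP yw) (eqP w0).
      have ai : after C j i.
        move: bi; rewrite /before negb_or -leqNgt => /andP[iC ji].
        by rewrite /after iC ltn_neqAle eq_sym ij.
      have /ffunP/(_ i) : celly C j y = celly C j y0.
        by rewrite (eqP yr); case/andP: FY0 => /eqP ->.
      by rewrite !ffunE ai => -[->].
    ring.
  have sumE h : \sum_(t | fib r w t) P t * bad (t.1 j) w (h t.2) =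
      \sum_(y | FY y) V y * E (h y).
    rewrite (eq_bigl (fun t => FX t.1 && FY t.2)) => [|t]; last first.
      by rewrite /fib /FX /FY andbA.
    rewrite (eq_bigr (fun t => P (t.1, t.2) * bad (t.1 j) w (h t.2))); last by case.
    rewrite -(pair_big FX FY (fun x y => P (x, y) * bad (x j) w (h y))) /=.
    rewrite exchange_big; apply: eq_bigr => y yF; rewrite mulr_sumr.
    by apply: eq_bigr => x xF; rewrite PUV// [RHS]mulrCA mulrA.
  (* The loss is a sum of [E (g y j)] with nonnegative weights [V y], so the answer given at a
     minimising [y1] is at least as good. *)
  case: (@Order.TotalTheory.arg_minP _ _ _ y0 FY (fun y => E (g y j)) FY0) => y1 _ y1min.
  exists (g y1 j); rewrite (sumE (fun=> g y1 j)) (sumE (fun y => g y j)).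
  apply: ler_sum => y yF; rewrite ler_wpM2l ?y1min//.
  by rewrite mulr_ge0 ?beta0 ?prodr_ge0.
have [G HG] := choice best.
exists (fun r => [ffun w => G (r, w)]).
have -> : \sum_r \sum_(u | (u.1, u.2, [ffun w => G (r, w)] u.2) \notin f)
    law C P j r u =
    \sum_r \sum_u law C P j r u * bad u.1 u.2 (G (r, u.2)).
  apply: eq_bigr => r _; rewrite big_mkcond; apply: eq_bigr => u _.
  by rewrite ffunE /bad; case: ifP => _; rewrite ?mulr1 ?mulr0.
rewrite (sum_law C P j (fun r u => bad u.1 u.2 (G (r, u.2)))) /=.
rewrite (partition_big (fun t => (cell C j t, t.2 j)) xpredT)//=.
rewrite [leRHS](partition_big (fun t => (cell C j t, t.2 j)) xpredT)//=.
apply: ler_sum => -[r w] _.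
have := HG (r, w); rewrite /= => h; apply: le_trans (le_trans _ h) _.
  rewrite le_eqVlt; apply/orP; left; apply/eqP.
  apply: eq_big => [t|t]; first by [].
  by rewrite xpair_eqE => /andP[/eqP -> /eqP ->].
rewrite [leRHS]big_mkcondl le_eqVlt; apply/orP; left; apply/eqP.
apply: eq_big => [t|t]; first by [].
by move=> /andP[_ /eqP <-]; rewrite /bad; case: ifP => _; rewrite ?mulr1 ?mulr0.
Qed.

(** As [a < 1], the default value 1 of the minimum is excluded, and an actual answer function meets
    the bound. *)
Lemma err_le_answer (R : realType) (A B D : finType) (h : {set A * B * D})
    (l : {ffun A * B -> R}) (a : R) : is_dist l -> a < 1 -> err h l <= a ->
  exists g : {ffun B -> D},
    1 - a <= \sum_(t | (t.1, t.2, g t.2) \in h) l t.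
Proof.
move=> [l0 l1] a1 /bigmin_leP[|[g _ ga]]; first by rewrite leNgt a1.
exists g; rewrite -l1 (bigID (fun t => (t.1, t.2, g t.2) \in h)) /=.
move: ga; rewrite /prob; lra.
Qed.

(** For fixed [y] the success weight factorises over coordinates, and each factor is largest for an
    answer depending on [y_i] alone; independence then gives a power of the single-game value. *)
Lemma sum_succ_dist_pow (R : realType) (X Y Z : finType) (f : {set X * Y * Z})
    (mu : {ffun X * Y -> R}) (k : nat)
    (g : {ffun {ffun 'I_k -> Y} -> {ffun 'I_k -> Z}}) (z0 : Z) :
  is_dist mu ->
  \sum_(t | (t.1, t.2, g t.2) \in rel_pow f k) dist_pow mu k t <=
  (1 - err f mu) ^+ k.
Proof.
move=> [mu0 mu1].
pose S w z := \sum_v mu (v, w) * ((v, w, z) \in f)%:R.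
have best w : exists z, forall z', S w z' <= S w z.
  case: (@Order.TotalTheory.arg_maxP _ _ _ z0 xpredT (S w) isT) => z _ zmax.
  by exists z => z'; exact: zmax.
have [G HG] := choice best.
have S0 w z : 0 <= S w z by apply: sumr_ge0 => v _; rewrite mulr_ge0.
have -> : \sum_(t | (t.1, t.2, g t.2) \in rel_pow f k) dist_pow mu k t =
    \sum_(y : {ffun 'I_k -> Y}) \prod_i S (y i) (g y i).
  rewrite big_mkcond /=.
  pose F (x : {ffun 'I_k -> X}) (y : {ffun 'I_k -> Y}) :=
    \prod_i (mu (x i, y i) * ((x i, y i, g y i) \in f)%:R).
  rewrite (eq_bigr (fun t => F t.1 t.2)) => [|[x y] _].
    rewrite -(pair_bigA _ F) exchange_big /=.
    apply: eq_bigr => y _.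
    by rewrite [in RHS]/S bigA_distr_bigA.
  rewrite inE /= /F ffunE /=; case: ifP => [/forallP h|/negbT].
    by apply: eq_bigr => i _; rewrite h mulr1.
  rewrite negb_forall => /existsP[i /negbTE hi].
  by rewrite (bigD1 i)//= hi mulr0 mul0r.
apply: (@le_trans _ _ (\sum_(y : {ffun 'I_k -> Y}) \prod_i S (y i) (G (y i)))).
  by apply: ler_sum => y _; apply: ler_prod => i _; rewrite S0 HG.
rewrite -(bigA_distr_bigA (fun (i : 'I_k) w => S w (G w))).
rewrite prodr_const card_ord lerXn2r ?nnegrE ?sumr_ge0//.
  rewrite subr_ge0; exact: bigmin_le_id.
rewrite lerBrDr.
apply: (@le_trans _ _ (\sum_w S w (G w) + prob mu (fun t =>
   (t.1, t.2, [ffun w => G w] t.2) \notin f))).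
  by rewrite lerD2l; exact: bigmin_le.
rewrite /prob [X in _ + X]big_mkcond.
rewrite exchange_big pair_bigA -big_split /= -[leRHS]mu1.
rewrite le_eqVlt; apply/orP; left; apply/eqP.
apply: eq_bigr => -[v w] _ /=; rewrite ffunE.
by case: (_ \in f); rewrite ?mulr1 ?mulr0 ?addr0 ?add0r.
Qed.

(* [C] is a largest set of coordinates with [Pr[T_C] <= (1 - eps/2)^#|C|]; then
   every other coordinate succeeds with probability at least [1 - eps/2] given
   [T_C]. *)
Lemma exists_one_way_of_succ (R : realType) (X Y Z : finType)
    (f : {set X * Y * Z}) (mu : {ffun X * Y -> R}) (k p : nat)
    (l : {ffun {ffun 'I_k -> X} * {ffun 'I_k -> Y} -> R})
    (g : {ffun {ffun 'I_k -> Y} -> {ffun 'I_k -> Z}}) (eps K t tau : R) :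
  let s := p%:R * - ln (1 - eps / 2) in
  is_dist mu -> is_dist l -> one_way (dist_pow mu k) l ->
  0 < K -> (forall u, l u <= K * dist_pow mu k u) ->
  0 < eps < 1 -> (p < k)%N -> 0 < t -> 0 < tau ->
  (1 - eps / 2) ^+ p <= \sum_(u | (u.1, u.2, g u.2) \in rel_pow f k) l u ->
  (forall n, (k - p <= n)%N ->
     n%:R * (eps / 2) + 4 * (t / 2 * s + n%:R * (2 / t)) +
     (ln K + s + n%:R) / tau <= n%:R * eps) ->
  exists l' : {ffun X * Y -> R}, [/\ is_dist l', one_way mu l',
    err f l' <= eps &
    \sum_(u | expR tau * 4 * cond12 mu u.1 u.2 < cond12 l' u.1 u.2) l' u <= eps].
Proof.
move=> s mu_dist [l0 l1] low K0 lK /andP[eps0 eps1] pk t0 tau0 succ num.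
have mu0 := mu_dist.1.
set q := 1 - eps / 2.
have q0 : 0 < q by rewrite /q; lra.
have q1 : q < 1 by rewrite /q; lra.
pose T (u : {ffun 'I_k -> X} * {ffun 'I_k -> Y}) i := (u.1 i, u.2 i, g u.2 i) \in f.
pose TC (S : {set 'I_k}) u := [forall i in S, T u i].
pose pC S := \sum_(u | TC S u) l u.
have h0 : pC finset.set0 <= q ^+ #|(finset.set0 : {set 'I_k})|.
  rewrite cards0 expr0 -l1 le_eqVlt; apply/orP; left; apply/eqP.
  by apply: eq_bigl => u; apply/forallP => i; rewrite inE.
case: (@arg_maxnP _ finset.set0 (fun S : {set 'I_k} => pC S <= q ^+ #|S|)
  (fun S => #|S|) h0) => C hC Cmax.
have pCp : q ^+ p <= pC C.
  apply: le_trans succ _; rewrite big_mkcond /pC [leRHS]big_mkcond.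
  apply: ler_sum => u _; rewrite inE /=; case: ifPn => [/forallP h|_].
    have -> // : TC C u.
    by apply/forallP => i; apply/implyP => _; exact: h.
  by case: ifP.
have Cp : (#|C| <= p)%N.
  rewrite leqNgt; apply/negP => pC'; have := le_trans pCp hC.
  by rewrite leNgt ltr_iXn2l ?pC'.
have pC0 : 0 < pC C by apply: lt_le_trans pCp; rewrite exprn_gt0.
have nextC j : j \notin C -> q * pC C <= pC (j |: C)%SET.
  move=> jC; apply: (@le_trans _ _ (q ^+ #|C|.+1)).
    by rewrite exprS ler_pM2l.
  rewrite leNgt; apply/negP => /ltW; have := Cmax (j |: C)%SET.
  by rewrite cardsU1 jC add1n => h /h /=; rewrite /geq /= ltnn.
pose n := #|[pred j | j \notin C]|.
have kn : (k - p <= n)%N.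
  have := cardC (mem C); rewrite card_ord => <-.
  by rewrite leq_subLR leq_add2r.
have n0 : (0 < n)%N by apply: leq_trans kn; rewrite subn_gt0.
pose P u := if TC C u then l u / pC C else 0.
have P0 u : 0 <= P u by rewrite /P; case: ifP => // _; rewrite divr_ge0// ltW.
have P1 : \sum_u P u = 1 by rewrite -big_mkcond -mulr_suml divff ?gt_eqF.
have lE x y : l (x, y) = marg1 l x * \prod_i cond21 mu (y i) (x i).
  rewrite (one_way_prod (@dist_pow_ge0 _ _ _ _ k mu_dist) l0 low).
  by rewrite cond21_dist_pow.
have Pl u : P u <= (pC C)^-1 * l u.
  rewrite /P mulrC; case: ifP => // _.
  by rewrite mulr_ge0// invr_ge0 ltW.
(* Conditioning on success costs at most [s] nats. *)
have lnp : - ln (pC C) <= s.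
  rewrite /s -/q mulrN lerN2 mulr_natl -lnXn//.
  by rewrite ler_ln ?posrE ?exprn_gt0.
have klx : \sum_(j | j \notin C) \sum_r \sum_u kl (law C P j r u)
    (marg2 (law C P j r) u.2 * cond12 mu u.1 u.2) <= ln K + s.
  apply: le_trans (sum_kl_law_x C mu_dist P0 P1 (K := K / pC C) _ _) _.
  - by rewrite divr_gt0.
  - move=> u; apply: le_trans (Pl u) _; rewrite mulrAC mulrC.
    by rewrite ler_pM2r ?invr_gt0.
  - by rewrite ln_div ?posrE// lerD2l.
(* [l] is one-way, so its law of [y] given [x] is exactly that of [mu^k]; only [1 / pC C] is
   lost. *)
have kly : \sum_(j | j \notin C) \sum_r \sum_u kl (law C P j r u)
    (resample mu (law C P j r) u) <= s.
  apply: le_trans (sum_kl_law_y C mu_dist P0 P1 (a := marg1 l)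
    (K := (pC C)^-1) _ _ _ _) _.
  - by rewrite invr_gt0.
  - by move=> x; exact: marg1_ge0.
  - by rewrite sum_marg1 l1.
  - by case=> x y; rewrite /= -lE; exact: Pl.
  - by rewrite lnV ?posrE.
have perr j : j \notin C ->
    \sum_(u | ~~ T u j) P u <= eps / 2.
  move=> jC.
  have : \sum_(u | T u j) P u = pC (j |: C)%SET / pC C.
    rewrite /P -big_mkcondr -mulr_suml; congr (_ / _).
    apply: eq_bigl => u; apply/andP/forallP => [[h1 /forallP h2] i|h].
      by rewrite !inE; apply/implyP => /orP[/eqP -> //|]; exact/implyP.
    split; first by have := h j; rewrite !inE eqxx.
    by apply/forallP => i; apply/implyP => iC; have := h i; rewrite !inE iC orbT.
  have := P1; rewrite (bigID (fun u => T u j)) /= => h1 h2.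
  have : q <= pC (j |: C)%SET / pC C by rewrite ler_pdivlMr ?nextC.
  rewrite -h2 /q; lra.
pose KX j := \sum_r \sum_u kl (law C P j r u)
  (marg2 (law C P j r) u.2 * cond12 mu u.1 u.2).
pose KY j := \sum_r \sum_u kl (law C P j r u) (resample mu (law C P j r) u).
have [j jC Hj] : exists2 j, j \in [pred j | j \notin C] &
    eps / 2 + 4 * (t / 2 * KY j + 2 / t) + (KX j + 1) / tau <= eps.
  apply: exists_le_sum => //; rewrite -/n.
  rewrite !big_split /= -!mulr_suml !big_split /= -!mulr_sumr !sumr_const -/n.
  apply: le_trans (num n kn).
  have H1 : t / 2 * (\sum_(j | j \notin C) KY j) <= t / 2 * s.
    by rewrite ler_pM2l// divr_gt0.
  have H2 : (\sum_(j | j \notin C) KX j + n%:R) / tau <= (ln K + s + n%:R) / tau.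
    by rewrite ler_pM2r ?invr_gt0// lerD2r.
  rewrite !big_split /= -mulr_sumr !sumr_const -/n -[_ *+ n]mulr_natl
    -[(2 / t) *+ n]mulr_natl.
  by lra.
have [z0 _] : exists z0 : Z, True.
  by have [u _] := support_nonempty P1; exists (g u.2 j).
(* Success on [C] depends on [x] only through [x_C], which every cell reveals; this is the form
   [best_answer] requires. *)
pose beta (x : {ffun 'I_k -> X}) (y : {ffun 'I_k -> Y}) : R :=
  if TC C (x, y) then (pC C)^-1 else 0.
have beta0 x y : 0 <= beta x y.
  by rewrite /beta; case: ifP => // _; rewrite invr_ge0 ltW.
have PE x y : P (x, y) = marg1 l x * beta x y * \prod_i cond21 mu (y i) (x i).
  rewrite /P /beta lE; case: ifP => _; last by rewrite mulr0 mul0r.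
  by rewrite mulrAC.
have betaC x x' y : cellx C j x = cellx C j x' -> beta x y = beta x' y.
  move=> /ffunP xx'; rewrite /beta; congr (if _ then _ else _).
  apply: eq_forallb => i; case: (boolP (i \in C)) => //= iC; rewrite /T /=.
  by have := xx' i; rewrite !ffunE /before iC => -[->].
have [G HG] := best_answer f g z0 beta0 (fun v w => cond21_ge0 w v mu0) PE betaC jC.
apply: (@exists_one_way R X Y Z f mu mu0 _ (law C P j) G eps t tau) => //.
- by move=> r u; exact: law_ge0.
- exact: sum_law1.
- move=> r u /(law_gt0 P0)[v Pv <-]; rewrite lt0r mu0 andbT.
  apply: contraTneq Pv => h; case: v h => x y h; rewrite PE (bigD1 j)//=.
  by rewrite /cond21 h mul0r mul0r mulr0 ltxx.
- apply: le_trans Hj; rewrite !lerD2r.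
  by apply: le_trans HG _; exact: perr.
Qed.

(** * Min-entropy *)

Lemma log2_ratioE (R : realType) (p q : R) : 0 < p -> 0 < q ->
  log2_ratio p q = (ln (p / q) / ln 2)%:E.
Proof.
move=> p0 q0; rewrite /log2_ratio inver gt_eqF// -EFinM lne_EFin ?divr_gt0//.
have l2 : 0 < ln (2 : R) by rewrite ln_gt0// ltr1n.
by rewrite inver gt_eqF// -EFinM.
Qed.

Section OneWay.
Variables (R : realType) (A B : finType) (nu l : {ffun A * B -> R}).
Hypotheses (nu_ge0 : forall t, 0 <= nu t) (l_ge0 : forall t, 0 <= l t).
Hypothesis l_nu : one_way nu l.

Lemma one_way_gt0 t : 0 < l t -> 0 < nu t.
Proof.
case: t => a b lab; rewrite lt0r nu_ge0 andbT; apply/eqP => h.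
have := cond21_gt0 l_ge0 lab; rewrite -l_nu//.
by rewrite /cond21 h mul0r ltxx.
Qed.

Lemma Sinf_le_pointwise (m : R) : (Sinf l nu <= m%:E)%E ->
  forall t, l t <= expR (m * ln 2) * nu t.
Proof.
move=> h t; have [l0|l0] := eqVneq (l t) 0.
  by rewrite l0 mulr_ge0 ?expR_ge0.
have lt : 0 < l t by rewrite lt0r l0 l_ge0.
have nt := one_way_gt0 lt.
have : (log2_ratio (l t) (nu t) <= m%:E)%E.
  by apply: le_trans h; exact: (le_bigmax _ (fun t => log2_ratio (l t) (nu t)) t).
rewrite log2_ratioE// lee_fin ler_pdivrMr ?ln_gt0 ?ltr1n// => h1.
by rewrite -ler_pdivrMr// -[leLHS]lnK ?posrE ?divr_gt0// ler_expR.
Qed.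

(** A negative value would put [l] below a multiple of [nu] by a factor less than 1, yet both have
    mass 1. *)
Lemma Sinf_ge0 : \sum_t l t = 1 -> \sum_t nu t = 1 -> (0 <= Sinf l nu)%E.
Proof.
move=> l1 nu1; rewrite leNgt; apply/negP => h.
have [m m0 hm] : exists2 m : R, m < 0 & (Sinf l nu <= m%:E)%E.
  case: (Sinf l nu) h => [s| |] //; first by rewrite lte_fin => s0; exists s.
  by move=> _; exists (-1); rewrite ?leNye// ltrN10.
have : \sum_t l t <= \sum_t expR (m * ln 2) * nu t.
  by apply: ler_sum => t _; exact: Sinf_le_pointwise.
rewrite l1 -mulr_sumr nu1 mulr1 leNgt expR_lt1.
by rewrite pmulr_llt0 ?m0// ln_gt0// ltr1n.
Qed.

Lemma prob_log2_ratio_cond12 (c : R) :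
  prob l (fun t => (c%:E < log2_ratio (cond12 l t.1 t.2) (cond12 nu t.1 t.2))%E) =
  \sum_(t | expR (c * ln 2) * cond12 nu t.1 t.2 < cond12 l t.1 t.2) l t.
Proof.
rewrite /prob big_mkcond [RHS]big_mkcond; apply: eq_bigr => -[a b] _ /=.
have [->|l0] := eqVneq (l (a, b)) 0; first by rewrite !if_same.
have lab : 0 < l (a, b) by rewrite lt0r l0 l_ge0.
have cl := cond12_gt0 l_ge0 lab; have cn := cond12_gt0 nu_ge0 (one_way_gt0 lab).
rewrite log2_ratioE// lte_fin ltr_pdivlMr ?ln_gt0 ?ltr1n//.
have r0 : cond12 l a b / cond12 nu a b \in Num.pos by rewrite posrE divr_gt0.
by rewrite -[in RHS]ltr_pdivlMr// -[in RHS](lnK r0) ltr_expR.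
Qed.

End OneWay.

Lemma crment_prob_gt (R : realType) (A B D : finType) (nu : {ffun A * B -> R})
    (eps delta : R) (h : {set A * B * D}) (c : R) (l : {ffun A * B -> R}) (d : R) :
  (c%:E <= crment nu eps delta h)%E -> is_dist nu ->
  is_dist l -> one_way nu l -> err h l <= eps -> d < c ->
  delta < \sum_(t | expR (d * ln 2) * cond12 nu t.1 t.2 < cond12 l t.1 t.2) l t.
Proof.
move=> hc [nu0 _] ldist low lerr dc.
rewrite -(prob_log2_ratio_cond12 nu0 ldist.1 low) ltNge; apply/negP => hd.
have : (crment nu eps delta h <= d%:E)%E.
  apply: (@le_trans _ _ (crment_dist nu delta l)).
    by apply: ereal_inf_lbound; exists l.
  by apply: ereal_inf_lbound; exists d.
by move=> /(le_trans hc); rewrite lee_fin leNgt dc.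
Qed.

(** * Numerical estimates *)

Section Numerics.
Variables (R : realType) (delta eps : R).
Hypotheses (delta_gt0 : 0 < 200 * Num.sqrt delta)
  (delta_eps : 200 * Num.sqrt delta < eps) (eps_lt : eps < 1 / 2).

Lemma delta_pos : 0 < delta.
Proof. by move: delta_gt0; rewrite pmulr_rgt0// sqrtr_gt0. Qed.

(** Squaring gives [40000 delta < eps^2], and [2 eps^2 < eps]. *)
Lemma delta_lt : (400 * 200) * delta < eps.
Proof.
have d0 := delta_pos; have s0 : 0 < Num.sqrt delta by rewrite sqrtr_gt0.
have := sqr_sqrtr (ltW d0); move: delta_eps eps_lt s0.
by move: (Num.sqrt delta) => s h1 h2 h3 h4; nra.
Qed.

Lemma delta_lt_sqr : (200 * 200) * delta < eps ^+ 2.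
Proof.
have d0 := delta_pos; have s0 : 0 < Num.sqrt delta by rewrite sqrtr_gt0.
have := sqr_sqrtr (ltW d0); move: delta_eps eps_lt s0.
by move: (Num.sqrt delta) => s h1 h2 h3 h4; nra.
Qed.

Lemma ln_half_le : - ln (1 - eps / 2) <= eps.
Proof.
have e0 := lt_trans delta_gt0 delta_eps; have h := eps_lt.
have q0 : 0 < 1 - eps / 2 by lra.
rewrite -lnV ?posrE//; apply: le_trans (ln_le_subr1 _) _; rewrite ?invr_gt0//.
rewrite lerBlDr -div1r ler_pdivrMr//; nra.
Qed.

(* [n] is the number of coordinates outside [C] and [gamma = c ln 2]; [100 / eps]
   and [gamma - 3] are the [t] and [tau] of [exists_one_way], the loss of 3 nats
   covering the factor 4 there. *)
Lemma large_numerics (k p n gamma lnK : R) :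
  0 < k -> 0 <= p -> p <= delta * k -> k - p <= n ->
  eps / 2 < delta * gamma -> lnK <= delta * k * gamma ->
  n * (eps / 2) +
  4 * (100 / eps / 2 * (p * - ln (1 - eps / 2)) + n * (2 / (100 / eps))) +
  (lnK + p * - ln (1 - eps / 2) + n) / (gamma - 3) <= n * eps.
Proof.
move=> k0 p0 pk kn dg hK.
have e0 := lt_trans delta_gt0 delta_eps; have e1 := eps_lt.
have d0 := delta_pos; have d1 := delta_lt; have d2 := delta_lt_sqr.
set s := p * _.
have s1 : s <= delta * k * eps.
  apply: (@le_trans _ _ (p * eps)); first by rewrite ler_wpM2l// ln_half_le.
  by rewrite ler_wpM2r// ltW.
have kn2 : k <= 2 * n by nra.
have n0 : 0 < n by lra.
(* Combine [eps / 2 < delta * gamma] with [40000 delta < eps^2]. *)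
have eg : (100 * 200) < eps * gamma.
  have : eps ^+ 2 * gamma > (100 * 200) * eps.
    have g0 : 0 < gamma by rewrite -(pmulr_rgt0 _ d0); lra.
    by have := ler_wpM2r (ltW g0) (ltW d2); lra.
  by move=> h; rewrite -(ltr_pM2r e0); lra.
have g0 : (200 * 200) < gamma by nra.
(* The shares of [n eps] are 1/2, 4 (1/100 + 1/50) and 1/4, in all 0.87. *)
have h1 : 100 / eps / 2 * s <= n * eps / 100.
  have -> : 100 / eps / 2 * s = 50 * s / eps by field; rewrite gt_eqF.
  rewrite ler_pdivrMr//.
  have : delta * k * eps <= delta * (2 * n) * eps.
    by rewrite ler_wpM2r ?(ltW e0)// ler_wpM2l// ltW.
  have : delta * n <= eps ^+ 2 / (200 * 200) * n by rewrite ler_wpM2r; lra.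
  have : 0 <= n * eps ^+ 2 by rewrite mulr_ge0 ?sqr_ge0 ?ltW.
  nra.
have h2 : n * (2 / (100 / eps)) = n * eps / 50 by field; rewrite gt_eqF.
have h3 : (lnK + s + n) / (gamma - 3) <= n * eps / 4.
  rewrite ler_pdivrMr; last by lra.
  have dk : delta * k <= eps / (200 * 200) * n by nra.
  have : delta * k * gamma <= eps / (200 * 200) * n * gamma by rewrite ler_wpM2r//; lra.
  have : delta * k * eps <= eps / (200 * 200) * n * 1.
    apply: ler_pM => //; [by rewrite mulr_ge0 ?ltW|exact: ltW|lra].
  have : n * (100 * 200) <= n * (eps * gamma) by rewrite ler_wpM2l ?ltW.
  have : n * eps <= n * 1 by rewrite ler_wpM2l; lra.
  lra.
rewrite h2; have : 0 <= n * eps by rewrite mulr_ge0 ?ltW.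
lra.
Qed.

End Numerics.

(** Indeed [exp (- x) >= 1 - eps / 2], and [1 - eps <= (1 - eps / 2)^2]. *)
Lemma expR_split (R : realType) (eps x : R) :
  0 < eps < 1 -> x <= eps / 2 -> expR x * (1 - eps) <= 1 - eps / 2.
Proof.
move=> /andP[e0 e1] xe.
have h : 1 - x <= expR (- x) by apply: expR_ge1Dx.
rewrite mulrC -ler_pdivlMr ?expR_gt0// -expRN.
apply: le_trans (ler_wpM2l _ h); last by lra.
have [x0|x0] := leP 0 x; nra.
Qed.

Theorem theorem5p1 (R : realType) (X Y Z : finType) (f : {set X * Y * Z})
  (f_complete : complete_rel f)
  (mu : {ffun X * Y -> R}) (mu_dist : is_dist mu)
  (delta eps : R)
  (delta_gt0 : 0 < 200 * Num.sqrt delta)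
  (delta_eps : 200 * Num.sqrt delta < eps)
  (eps_lt : eps < 1 / 2)
  (k : nat) :
  (rment (dist_pow mu k)
     (1 - (1 - eps / 2) ^ Num.floor (delta * k%:R))%R (rel_pow f k)
   >= (delta * k%:R)%:E * crment mu eps eps f)%E.
Proof.
have mu0 := mu_dist.1.
have d0 := delta_pos delta_gt0.
have dlt := delta_lt delta_gt0 delta_eps eps_lt.
have e0 := lt_trans delta_gt0 delta_eps.
have dk0 : 0 <= delta * k%:R by rewrite mulr_ge0 ?(ltW d0).
apply/ereal_infP => _ [l [ldist low lerr] <-].
have nu0 := @dist_pow_ge0 _ _ _ _ k mu_dist.
have S0 := Sinf_ge0 nu0 ldist.1 low ldist.2 (sum_dist_pow k mu_dist).
rewrite leNgt; apply/negP => Slt.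
(* A real [c] is needed even if [crment] is infinite: for [+oo] any large enough value serves, and
   [-oo] contradicts [S0]. *)
have [c [m [hc Sm mc]]] : exists c m : R, [/\ (c%:E <= crment mu eps eps f)%E,
    Sinf l (dist_pow mu k) = m%:E & m < delta * k%:R * c].
  case: (Sinf _ _) S0 Slt => [m|_|//]; last by rewrite ltNge leey.
  rewrite lee_fin => m0.
  case: (crment _ _ _ _) => [c||].
  - by rewrite -EFinM lte_fin => h; exists c, m.
  - have [dk|dk] := eqVneq (delta * k%:R) 0.
      by rewrite dk mul0e lte_fin ltNge m0.
    move=> _; exists ((m + 1) / (delta * k%:R)), m; split=> //.
      by rewrite leey.
    by rewrite mulrC divfK// ltrDl.
  - have [->|dk] := eqVneq (delta * k%:R) 0.
      by rewrite mul0e lte_fin ltNge m0.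
    by rewrite gt0_muleNy ?lte_fin ?lt0r ?dk.
have m0 : 0 <= m by rewrite -lee_fin -Sm.
have hgt := crment_prob_gt hc mu_dist.
have ln2 : 0 < ln (2 : R) by rewrite ln_gt0// ltr1n.
have k0 : (0 < k)%N.
  by rewrite lt0n; apply: contraTneq mc => ->; rewrite mulr0 mul0r -leNgt.
have kR : 0 < k%:R :> R by rewrite ltr0n.
have c0 : 0 < c.
  by have := le_lt_trans m0 mc; rewrite pmulr_rgt0// mulr_gt0.
have lK : forall u, l u <= expR (m * ln 2) * dist_pow mu k u.
  by apply: Sinf_le_pointwise => //; [exact: ldist.1|rewrite Sm].
pose p := `|Num.floor (delta * k%:R)|%N.
have pE : Num.floor (delta * k%:R) = p :> int.
  by rewrite /p gez0_abs// floor_ge0.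
have pk : p%:R <= delta * k%:R.
  by have := floor_le (delta * k%:R); rewrite pE.
have plt : (p < k)%N.
  rewrite -(ltr_nat R); apply: le_lt_trans pk _.
  by rewrite gtr_pMl//; lra.
have q0 : 0 < 1 - eps / 2 by lra.
have q1 : 1 - eps / 2 < 1 by lra.
have qp0 : 0 < (1 - eps / 2) ^+ p by rewrite exprn_gt0.
move: lerr; rewrite pE -exprnP => lerr.
have lt1 : 1 - (1 - eps / 2) ^+ p < 1 by rewrite gtrBl.
have [g] := err_le_answer ldist lt1 lerr; rewrite subKr => succ.
have [small|large] := leP (delta * (c * ln 2)) (eps / 2).
  have [z0 _] : exists z0 : Z, True.
    by have [u _] := support_nonempty ldist.2; exists (g u.2 (Ordinal k0)).
  (* [mu] is one-way for itself with all log-ratios at most 0 [< c]; were its error at most [eps],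
     it would contradict the choice of [c]. *)
  have err_mu : eps < err f mu.
    rewrite ltNge; apply/negP => emu.
    have := hgt mu 0 mu_dist (fun _ _ _ => erefl) emu c0.
    rewrite mul0r expR0 big_pred0 => [|t]; first by rewrite ltNge (ltW e0).
    by rewrite mul1r ltxx.
  have : (1 - eps / 2) ^+ p <= expR (m * ln 2) * (1 - eps) ^+ k.
    apply: le_trans succ _.
    apply: (@le_trans _ _ (expR (m * ln 2) * \sum_(u |
        (u.1, u.2, g u.2) \in rel_pow f k) dist_pow mu k u)).
      by rewrite mulr_sumr; apply: ler_sum.
    rewrite ler_pM2l ?expR_gt0//.
    apply: le_trans (sum_succ_dist_pow _ _ z0 mu_dist) _.
    by rewrite lerXn2r ?nnegrE//; [rewrite subr_ge0; exact: bigmin_le_id|lra|lra].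
  apply/negP; rewrite -ltNge.
  apply: (@lt_le_trans _ _ (expR (delta * (c * ln 2) * k%:R) * (1 - eps) ^+ k)).
    rewrite ltr_pM2r; last by rewrite exprn_gt0//; lra.
    rewrite ltr_expR; have := mc; rewrite -(ltr_pM2r ln2); lra.
  rewrite expRM_natr -exprMn.
  apply: (@le_trans _ _ ((1 - eps / 2) ^+ k)).
    rewrite lerXn2r ?nnegrE ?mulr_ge0 ?expR_ge0//; [lra|lra|].
    by apply: expR_split => //; lra.
  by rewrite ler_wiXn2l ?(ltnW plt)// ltW.
have lnKle : ln (expR (m * ln 2)) <= delta * k%:R * (c * ln 2).
  rewrite expRK; have := mc; rewrite -(ltr_pM2r ln2); lra.
(* This makes [tau = c ln 2 - 3] positive. *)
have gam : 3 < c * ln 2 by nra.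
have [] := @exists_one_way_of_succ R X Y Z f mu k p l g eps (expR (m * ln 2))
  (100 / eps) (c * ln 2 - 3) mu_dist ldist low (expR_gt0 _) lK _ plt _ _ succ _.
- by apply/andP; split; lra.
- by rewrite divr_gt0.
- by lra.
- move=> n kn; apply: (large_numerics delta_gt0 delta_eps eps_lt kR _ pk) => //.
  by rewrite -natrB ?ler_nat// ltnW.
move=> l' [l'dist l'ow l'err]; apply/negP; rewrite -ltNge.
(* The level is one nat below [c]; the two nats left of the three cover the factor 4, since
   [exp 2 >= 4]. *)
apply: lt_le_trans (hgt l' (c - (ln 2)^-1) l'dist l'ow l'err _) _.
  by rewrite gtrBl invr_gt0.
rewrite mulrBl mulVf ?gt_eqF//.
rewrite [leLHS]big_mkcond [leRHS]big_mkcond; apply: ler_sum => u _.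
case: ifPn => [h|_]; last by case: ifP => // _; exact: l'dist.1.
rewrite ifT//; apply: le_lt_trans h; rewrite ler_wpM2r ?cond12_ge0//.
have -> : c * ln 2 - 1 = c * ln 2 - 3 + (1 + 1) :> R by ring.
move: (c * ln 2 - 3) => a.
rewrite !expRD ler_wpM2l ?expR_ge0//.
have := @expR_ge1Dx R 1; nra.
Qed.
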